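(* For every $d\geq 2$ we have $det^{S^3}(E^{(3)}_d)\neq 0$. In particular, the map $det^{S^3}:V_d^{\otimes\binom{3d}{3}}\to k$ is nontrivial.
   Context: $k$ is a field of characteristic zero, $\otimes=\otimes_k$, and $V_d$ is a $k$-vector space of dimension $d$ with basis $\{e_1,\dots,e_d\}$. Definition of $det^{S^3}$. Given $v_{i,j,l}\in V_d$ for $1\leq i<j<l\leq 3d$, for each $1\leq m<n\leq 3d$ let $\mathcal{E}_{m,n}$ be the vector equation (with scalar unknowns $\lambda_{i,j,l}$) $$\sum_{r=1}^{m-1}(-1)^{r-1}\lambda_{r,m,n}v_{r,m,n}+\sum_{s=m+1}^{n-1}(-1)^s\lambda_{m,s,n}v_{m,s,n}+\sum_{t=n+1}^{3d}(-1)^{t+1}\lambda_{m,n,t}v_{m,n,t}=0.$$ In the basis $e_1,\dots,e_d$ each $\mathcal{E}_{m,n}$ is a block of $d$ scalar linear equations. Let $A_{3d}((v_{i,j,l}))$ be the $d\binom{3d-1}{2}\times d\binom{3d-1}{2}$ coefficient matrix of the system of the equations $\mathcal{E}_{m,n}$ with $1\leq m<n<3d$ (columns indexed by triples, row blocks by pairs, in lexicographic order). Then $det^{S^3}:V_d^{\otimes\binom{3d}{3}}\to k$ is the linear map with $det^{S^3}(\otimes_{1\leq i<j<l\leq 3d}(v_{i,j,l}))=\det(A_{3d}((v_{i,j,l})))$. Definition of $E^{(3)}_d$. For $1\leq a\leq d$ let $S_a=\{3a-2,3a-1,3a\}$. For $1\leq i<j<l\leq 3d$ let $a\le b\le c$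 be the indices with $i\in S_a$, $j\in S_b$, $l\in S_c$, and define $e_{i,j,l}\in V_d$ by $$e_{i,j,l}=\begin{cases}e_a & \text{if } i+j+l\equiv 0 \pmod 3,\\ e_b & \text{if } i+j+l\equiv 1 \pmod 3,\\ e_c & \text{if } i+j+l\equiv 2 \pmod 3.\end{cases}$$ Then $E^{(3)}_d=\otimes_{1\leq i<j<l\leq 3d}(e_{i,j,l})\in V_d^{\otimes\binom{3d}{3}}$. *)

(* Defs.v *)
From HB Require Import structures.
From mathcomp Require Import all_boot all_order all_algebra.
From mathcomp Require Import zify.

Set Implicit Arguments.
Unset Strict Implicit.
Unset Printing Implicit Defensive.

Import GRing.Theory.
Local Open Scope ring_scope.

(* Tensor powers V^{(x) I}, I a finite type, of a finite dimensional space V. *)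
(* The carrier consists of the coordinate arrays on the basis of pure tensors *)
(* of vectors of vbasis fullv; the universal property is proved below         *)
(* (tlift_pure, tpow_ext), so this choice of coordinates is immaterial.       *)

Section TensorPower.
Variables (k : fieldType) (V : vectType k) (I : finType).

Definition tpow : vectType k := {ffun {ffun I -> 'I_(\dim {:V})} -> k^o}.

Definition pure (v : {ffun I -> V}) : tpow :=
  [ffun g : {ffun I -> 'I_(\dim {:V})} =>
     \prod_i coord (vbasis {:V}) (g i) (v i) : k^o].

Definition upd (v : {ffun I -> V}) (i : I) (x : V) : {ffun I -> V} :=
  [ffun j => if j == i then x else v j].

Definition multilinear (W : lmodType k) (f : {ffun I -> V} -> W) : Prop :=
  forall v i, linear (fun x => f (upd v i x)).

Definition tlift (W : lmodType k) (f : {ffun I -> V} -> W) (x : tpow) : W :=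
  \sum_g (x g : k) *: f [ffun i => (vbasis {:V})`_(g i)].

Lemma tlift_is_linear (W : lmodType k) (f : {ffun I -> V} -> W) :
  linear (tlift f).
Proof.
move=> a x y; rewrite /tlift scaler_sumr -big_split /=.
by apply: eq_bigr => g _; rewrite !ffunE scalerDl scalerA.
Qed.

HB.instance Definition _ (W : lmodType k) (f : {ffun I -> V} -> W) :=
  GRing.isLinear.Build k tpow W _ (tlift f) (@tlift_is_linear W f).

Lemma updE v i x j : upd v i x j = if j == i then x else v j.
Proof. by rewrite ffunE. Qed.

Lemma upd_id v i : upd v i (v i) = v.
Proof. by apply/ffunP=> j; rewrite updE; case: eqP => [->|]. Qed.

Lemma upd_upd v i x y : upd (upd v i x) i y = upd v i y.
Proof. by apply/ffunP=> j; rewrite !updE; case: eqP. Qed.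

Lemma multilinear_sum (W : lmodType k) (f : {ffun I -> V} -> W) v i
    (J : finType) (a : J -> k) (x : J -> V) : multilinear f ->
  f (upd v i (\sum_j a j *: x j)) = \sum_j a j *: f (upd v i (x j)).
Proof.
move=> fl; have f0 : f (upd v i 0) = 0.
  have := fl v i (-1) 0 0; rewrite scaler0 addr0 => ->.
  by rewrite scaleN1r addNr.
by elim/big_rec2: _ => // j y z _ <-; rewrite fl.
Qed.

Lemma pureE v (g : {ffun I -> 'I_(\dim {:V})}) :
  pure v g = \prod_i coord (vbasis {:V}) (g i) (v i).
Proof. by rewrite ffunE. Qed.

Lemma tpowPE (a : k) (x y : tpow) g : (a *: x + y) g = a * (x g : k) + (y g : k).
Proof. by rewrite !ffunE. Qed.

Lemma tpowZE (a : k) (x : tpow) g : (a *: x) g = a * (x g : k).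
Proof. by rewrite ffunE. Qed.

Lemma pure_multilinear : multilinear pure.
Proof.
move=> v i a x y; apply/ffunP=> g; rewrite tpowPE !pureE.
have E z : \prod_j coord (vbasis {:V}) (g j) (upd v i z j) =
    coord (vbasis {:V}) (g i) z *
    \prod_(j | j != i) coord (vbasis {:V}) (g j) (v j).
  rewrite (bigD1 i) //= updE eqxx; congr (_ * _).
  by apply: eq_bigr => j /negPf ji; rewrite updE ji.
rewrite !E; have -> : coord (vbasis {:V}) (g i) (a *: x + y) =
  a * coord (vbasis {:V}) (g i) x + coord (vbasis {:V}) (g i) y.
  exact: linearP.
by rewrite mulrDl mulrA.
Qed.

Let bas (g : {ffun I -> 'I_(\dim {:V})}) : {ffun I -> V} :=
  [ffun i => (vbasis {:V})`_(g i)].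

Let pure_bas g h : pure (bas g) h = (g == h)%:R.
Proof.
have fb : free (vbasis {:V}) by case/andP: (vbasisP {:V}).
rewrite pureE; case: eqP => [->|gh].
  by rewrite big1 // => i _; rewrite ffunE coord_free // eqxx.
have [i gi] : exists i, g i != h i.
  apply/existsP; rewrite -[[exists _, _]]negbK negb_exists.
  apply/forallP => e; apply: gh; apply/ffunP=> i.
  by apply/eqP; have := e i; rewrite negbK.
by rewrite (bigD1 i) //= ffunE coord_free // [_ == _](negPf gi) mul0r.
Qed.

Let tpow_bas (x : tpow) : x = \sum_g (x g : k) *: pure (bas g).
Proof.
apply/ffunP=> h; rewrite sum_ffunE (bigD1 h) //=.
have E g : (((x g : k) *: pure (bas g)) : tpow) h = (x g : k) * (g == h)%:R.
  by rewrite tpowZE pure_bas.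
rewrite E eqxx mulr1 big1 ?addr0 // => g /negPf gh.
by rewrite E gh mulr0.
Qed.

Lemma tpow_ext (W : lmodType k) (F G : {linear tpow -> W}) :
  (forall v, F (pure v) = G (pure v)) -> F =1 G.
Proof.
move=> FG x; rewrite (tpow_bas x) !linear_sum; apply: eq_bigr => g _.
by rewrite !linearZ /= FG.
Qed.

Lemma multilinear_ext (W : lmodType k) (f f' : {ffun I -> V} -> W) :
  multilinear f -> multilinear f' -> (forall g, f (bas g) = f' (bas g)) ->
  f =1 f'.
Proof.
move=> fl fl' ff' v.
suff H (s : seq I) (u : {ffun I -> V}) :
    (forall i, i \notin s ->
       exists c : 'I_(\dim {:V}), u i = (vbasis {:V})`_c) -> f u = f' u.
  by apply: (H (enum I)) => i; rewrite mem_enum.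
elim: s u => [|i s IH] u us.
  have us' i : exists c : 'I_(\dim {:V}), u i == (vbasis {:V})`_c.
    by have [//|c ->] := us i; exists c.
  have -> : u = bas [ffun i => xchoose (us' i)].
    by apply/ffunP => i; rewrite !ffunE; apply/eqP; apply: (xchooseP (us' i)).
  exact: ff'.
rewrite -(upd_id u i) (coord_vbasis (memvf (u i))) !multilinear_sum //.
apply: eq_bigr => c _; congr (_ *: _); apply: IH => j js.
rewrite updE; case: eqP => [_|/eqP ji]; first by exists c.
by apply: us; rewrite inE negb_or ji.
Qed.

Lemma tlift_pure (W : lmodType k) (f : {ffun I -> V} -> W) :
  multilinear f -> forall v, tlift f (pure v) = f v.
Proof.
move=> fl; apply: multilinear_ext => // [v i a x y|g].
  by rewrite pure_multilinear linearP.
rewrite /tlift (bigD1 g) //= big1 ?addr0 => [|h hg].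
  by rewrite pure_bas eqxx scale1r.
by rewrite pure_bas eq_sym (negPf hg) scale0r.
Qed.

End TensorPower.

(* Pairs 1 <= m < n <= N and triples 1 <= i < j < l <= N, lexicographically. *)

Definition pairs (N : nat) : seq (nat * nat) :=
  [seq p <- [seq (m, n) | m <- iota 1 N, n <- iota 1 N] | (p.1 < p.2)%N].

Definition triples (N : nat) : seq (nat * nat * nat) :=
  [seq t <- [seq (p, l) | p <- [seq (i, j) | i <- iota 1 N, j <- iota 1 N],
                          l <- iota 1 N]
          | (t.1.1 < t.1.2 < t.2)%N].

Lemma mem_allpairs_pair (S T : eqType) (s : seq S) (t : seq T) x y :
  ((x, y) \in [seq (a, b) | a <- s, b <- t]) = (x \in s) && (y \in t).
Proof.
apply/allpairsP/andP => [[[a b] [/= ? ? [-> ->]]] //|[xs yt]].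
by exists (x, y).
Qed.

Lemma mem_pairs N m n : ((m, n) \in pairs N) = (0 < m < n)%N && (n <= N)%N.
Proof. by rewrite mem_filter mem_allpairs_pair !mem_iota /=; lia. Qed.

Lemma mem_triples N i j l :
  ((i, j, l) \in triples N) = (0 < i < j)%N && (j < l <= N)%N.
Proof. by rewrite mem_filter !mem_allpairs_pair !mem_iota /=; lia. Qed.

Lemma pairs_uniq N : uniq (pairs N).
Proof.
by rewrite filter_uniq // allpairs_uniq ?iota_uniq // => -[? ?] [? ?].
Qed.

Lemma triples_uniq N : uniq (triples N).
Proof.
rewrite filter_uniq // allpairs_uniq ?iota_uniq // => [|[? ?] [? ?]] //.
by rewrite allpairs_uniq ?iota_uniq // => -[? ?] [? ?].
Qed.

Lemma count_lt N j : (j <= N)%N -> count (fun i => i < j)%N (iota 1 N) = j.-1.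
Proof.
move=> jN; case: j jN => [|j] jN; first by rewrite (@eq_count _ _ pred0) ?count_pred0.
rewrite -[N in iota 1 N](subnKC (ltnW jN)) iotaD count_cat.
rewrite (@eq_in_count _ _ predT) ?count_predT ?size_iota => [|i]; last first.
  by rewrite mem_iota add1n => /andP[_ ->].
rewrite (@eq_in_count _ _ pred0) ?count_pred0 ?addn0 // => i.
by rewrite mem_iota add1n => /andP[h _] /=; rewrite ltnNge h.
Qed.

Lemma size_pairs N : size (pairs N) = 'C(N, 2).
Proof.
rewrite size_filter -sum1_count big_mkcond big_allpairs_dep /= exchange_big /=.
rewrite (eq_big_seq predn) => [|j]; last first.
  rewrite mem_iota add1n ltnS => /andP[_ jN].
  by rewrite -big_mkcond /= sum1_count count_lt.
have -> : iota 1 N = index_iota 1 N.+1 by rewrite /index_iota subn1.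
by rewrite big_add1 /= -bin2_sum big_mkord.
Qed.

Lemma size_triples N : size (triples N) = 'C(N, 3).
Proof.
rewrite size_filter -sum1_count big_mkcond big_allpairs_dep /= exchange_big /=.
transitivity (\sum_(l <- iota 1 N) 'C(l.-1, 2))%N; last first.
  have -> : iota 1 N = index_iota 1 N.+1 by rewrite /index_iota subn1.
  rewrite big_add1 /=; elim: N => [|N IH]; first by rewrite big_geq.
  by rewrite big_nat_recr //= IH binS addnC.
apply: eq_big_seq => l; rewrite mem_iota add1n ltnS => /andP[l0 lN].
rewrite big_allpairs_dep exchange_big /=.
transitivity (\sum_(j <- iota 1 N) if (j < l)%N then j.-1 else 0)%N.
  apply: eq_big_seq => j; rewrite mem_iota add1n ltnS => /andP[_ jN].
  case: ifP => jl; last by rewrite big1 // => i _; rewrite andbF.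
  under eq_bigr do rewrite andbT.
  by rewrite -big_mkcond /= sum1_count count_lt.
rewrite -big_mkcond /= -bin2_sum.
have -> : iota 1 N = index_iota 1 N.+1 by rewrite /index_iota subn1.
rewrite (big_cat_nat (n := l)) //=; last exact: ltnW.
rewrite [X in (_ + X)%N]big_nat_cond [X in (_ + X)%N]big_pred0 ?addn0 => [|j]; last by lia.
rewrite big_nat_cond (eq_bigl (fun j => (1 <= j < l)%N && true)) => [|j]; last by lia.
by rewrite -big_nat_cond -[X in \sum_(1 <= _ < X) _]prednK // big_add1.
Qed.

Lemma size_triples3 d : size (triples (3 * d)) = (d * 'C((3 * d).-1, 2))%N.
Proof.
rewrite size_triples; apply/eqP; rewrite -(eqn_pmul2l (isT : 0 < 3)%N).
by case: d => // d; rewrite -mul_bin_diag mulnA.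
Qed.

(* The index a such that i lies in S_a = {3a-2, 3a-1, 3a}. *)
Definition blk (i : nat) : nat := ((i + 2) %/ 3)%N.

Lemma blkP i a : (0 < a)%N ->
  (i \in [:: 3 * a - 2; 3 * a - 1; 3 * a])%N = (0 < i)%N && (blk i == a).
Proof. by rewrite !inE /blk; lia. Qed.

Section DetS3.
Variables (k : fieldType) (V : vectType k) (d : nat) (e : d.-tuple V).

(* The index type of the tensor factors: v_{i,j,l}, 1 <= i < j < l <= 3d. *)
Definition trip : predArgType := seq_sub (triples (3 * d)).
HB.instance Definition _ := SubFinite.on trip.

(* v_{i,j,l}, extended by 0 to the (i, j, l) that are not in range. *)
Definition at3 (v : {ffun trip -> V}) (i j l : nat) : V :=
  if insub (i, j, l) is Some t then v t else 0.

(* The left-hand side of the equation E_{m,n} at lambda. *)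
Definition eqn_lhs (v : {ffun trip -> V}) (lam : nat * nat * nat -> k)
    (m n : nat) : V :=
    \sum_(1 <= r < m) ((-1) ^+ r.-1 * lam (r, m, n)) *: at3 v r m n
  + \sum_(m.+1 <= s < n) ((-1) ^+ s * lam (m, s, n)) *: at3 v m s n
  + \sum_(n.+1 <= t < (3 * d).+1) ((-1) ^+ t.+1 * lam (m, n, t)) *: at3 v m n t.

Lemma row_gt0 n (p : 'I_(d * n)) : (0 < d)%N.
Proof. by case: d p => // -[]. Qed.

(* Row p is the coordinate p %% d of the equation of pair number p %/ d; the  *)
(* coefficient of lambda_t in a linear form is its value at the unit vector   *)
(* of t.                                                                      *)
Definition A3 (v : {ffun trip -> V}) : 'M[k]_(d * 'C((3 * d).-1, 2)) :=
  \matrix_(p, q)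
    let mn := nth (0, 0)%N (pairs (3 * d).-1) (p %/ d) in
    let c := Ordinal (ltn_pmod p (row_gt0 p)) in
    let t := nth (0, 0, 0)%N (triples (3 * d)) q in
    coord e c (eqn_lhs v (fun u => (u == t)%:R) mn.1 mn.2).

Definition detS3 : {linear tpow V trip -> k^o} :=
  tlift (fun v => \det (A3 v) : k^o).

Lemma eqn_lhs_eq v v' lam m n :
  (forall i j l, lam (i, j, l) = 0 \/ at3 v i j l = at3 v' i j l) ->
  eqn_lhs v lam m n = eqn_lhs v' lam m n.
Proof.
move=> H; rewrite /eqn_lhs; congr (_ + _ + _); apply: eq_bigr => r _.
- by case: (H r m n) => ->; rewrite ?mulr0 ?scale0r.
- by case: (H m r n) => ->; rewrite ?mulr0 ?scale0r.
- by case: (H m n r) => ->; rewrite ?mulr0 ?scale0r.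
Qed.

Lemma eqn_lhs_lin v v' v'' a lam m n :
  (forall i j l, lam (i, j, l) = 0 \/
     at3 v i j l = a *: at3 v' i j l + at3 v'' i j l) ->
  eqn_lhs v lam m n = a *: eqn_lhs v' lam m n + eqn_lhs v'' lam m n.
Proof.
move=> H; rewrite /eqn_lhs.
have E (F : nat -> nat * nat * nat) (s : nat -> k) x y :
  \sum_(x <= r < y) (s r * lam (F r)) *: at3 v (F r).1.1 (F r).1.2 (F r).2 =
  a *: (\sum_(x <= r < y) (s r * lam (F r)) *: at3 v' (F r).1.1 (F r).1.2 (F r).2)
  + \sum_(x <= r < y) (s r * lam (F r)) *: at3 v'' (F r).1.1 (F r).1.2 (F r).2.
  rewrite scaler_sumr -big_split /=; apply: eq_bigr => r _.
  case: (F r) => -[i j] l /=.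
  case: (H i j l) => ->; first by rewrite mulr0 !scale0r scaler0 addr0.
  by rewrite scalerDr !scalerA mulrC.
rewrite (E (fun r => (r, m, n))) (E (fun r => (m, r, n))) (E (fun r => (m, n, r))) /=.
by rewrite !scalerDr [X in X + _ = _]addrACA [LHS]addrACA.
Qed.

Lemma at3_upd v (u : trip) x i j l :
  at3 (upd v u x) i j l = if (i, j, l) == val u then x else at3 v i j l.
Proof.
rewrite /at3; case: eqP => [->|ne]; first by rewrite valK updE eqxx.
by case: insubP => // w _ wE; rewrite updE; case: eqP => // wu; case: ne; rewrite -wE wu.
Qed.

Lemma detA3_multilinear : multilinear (fun v => \det (A3 v) : k^o).
Proof.
move=> v u a x y; set T := triples (3 * d).
have uT : val u \in T by apply: valP.
have q0P : (index (val u) T < d * 'C((3 * d).-1, 2))%N.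
  by rewrite -size_triples3 index_mem.
pose q0 := Ordinal q0P.
have nth_q0 : nth (0, 0, 0)%N T q0 = val u by rewrite nth_index.
have ne0 q : q != q0 -> nth (0, 0, 0)%N T q != val u.
  by rewrite -nth_q0 nth_uniq ?triples_uniq // size_triples3.
have R z w : row' q0 (A3 (upd v u z))^T = row' q0 (A3 (upd v u w))^T.
  apply/matrixP=> q p; rewrite !mxE /= -/T; congr (coord _ _ _).
  apply: eqn_lhs_eq => i j l; rewrite !at3_upd.
  case: (eqVneq (i, j, l) (nth _ _ _)) => [->|]; last by left.
  right; have := ne0 (lift q0 q); rewrite eq_sym neq_lift => /(_ isT).
  by move/negPf=> ->.
rewrite -!(det_tr (A3 _)).
rewrite (@determinant_multilinear _ _ _ (A3 (upd v u x))^T (A3 (upd v u y))^T q0 a 1) //.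
  by rewrite mul1r.
apply/rowP=> p; rewrite !mxE /= -/T nth_index // mul1r.
rewrite (@eqn_lhs_lin _ (upd v u x) (upd v u y) a) ?linearP // => i j l.
rewrite !at3_upd; case: (eqVneq (i, j, l) (val u)) => _; [by right|by left].
Qed.

Lemma detS3_pure v : detS3 (pure v) = \det (A3 v).
Proof. exact: (tlift_pure detA3_multilinear). Qed.

Definition e3 (i j l : nat) : V :=
  let a := match ((i + j + l) %% 3)%N with
           | 0 => blk i
           | 1 => blk j
           | _ => blk l
           end in
  e`_a.-1.

Definition E3 : tpow V trip :=
  pure [ffun t : trip => let: (i, j, l) := ssval t in e3 i j l].

End DetS3.

(* Main.v *)
(** Sorting the rows and columns of the matrix by colour, where the colour of
    a triangle (i,j,l) is the index of the basis vector e_{i,j,l}, and changing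
    the signs of rows and columns, a left kernel vector of the matrix is a family
    (phi_c) of 1-cochains on the complete graph on 1..3d such that phi_c vanishes
    on the edges at the vertex 3d and is closed on every triangle of colour c.
    So it suffices that a cochain which is closed on the triangles of one colour
    is exact.  Call r(y) = y mod 3 the residue of a vertex y below the block S_c,
    and r(y) = y + 1 mod 3 that of a vertex above it.  The triangles of colour c
    are then: S_c itself; {y,s,p} with y outside S_c, s and p in S_c and
    s = r(y) mod 3; and {y,z,p} with y, z outside S_c, p in S_c and
    p = 2 - r(y) - r(z) mod 3.  Thus a potential on S_c extends along the edges
    {y,s}, the triangles {y,s,p} give exactness on the edges {y,p}, and the
    triangles {y,z,p} give it on the edges {y,z}. *)

Require Import Defs.
From HB Require Import structures.
From mathcomp Require Import all_boot all_order all_algebra.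
From mathcomp Require Import zify ring.

Set Implicit Arguments.
Unset Strict Implicit.
Unset Printing Implicit Defensive.

Import GRing.Theory.
Local Open Scope ring_scope.

(* The colour is 0-based: e_{i,j,l} is the basis vector of index colour + 1. *)
Definition colour (i j l : nat) : nat :=
  (match (i + j + l) %% 3 with 0 => blk i | 1 => blk j | _ => blk l end).-1.

Ltac colour_lia :=
  rewrite /colour; let E := fresh in case E: (_ %% 3)%N => [|[|?]];
  rewrite /blk; lia.

(** * Cochains closed on the triangles of one colour *)

Section MonochromaticCochain.
Variables (V : zmodType) (N c : nat) (phi : nat -> nat -> V).
Hypothesis blk_le : (3 * c + 3 <= N)%N.
Hypothesis phi_anti : forall x y, phi x y = - phi y x.
Hypothesis phi_diag : forall x, phi x x = 0.
Hypothesis phi_closed : forall i j l, (0 < i < j)%N -> (j < l <= N)%N ->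
  colour i j l = c -> phi i j + phi j l = phi i l.

Let inS y := (3 * c < y <= 3 * c + 3)%N.

(* The vertex of S_c of residue r(y); it is y itself for y in S_c. *)
Let anchor y := (3 * c + 1 + (y + 2 + (3 * c + 3 < y)) %% 3)%N.

(** The integral of [phi] along the path [3c+1], [anchor y], [y]. *)
Let pot y := phi (3 * c + 1) (anchor y) + phi (anchor y) y.

Let anchorP y : inS (anchor y).
Proof. by rewrite /inS /anchor; lia. Qed.

Let anchor_id y : inS y -> anchor y = y.
Proof. by rewrite /inS /anchor; lia. Qed.

(** Closedness is given for increasing triples only; these two transpositions carry it to every
    order of the vertices. *)
Let closedC12 x y z : phi x y + phi y z = phi x z -> phi y x + phi x z = phi y z.
Proof. by move=> <-; rewrite addrA [phi y x]phi_anti addNr add0r. Qed.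

Let closedC23 x y z : phi x y + phi y z = phi x z -> phi x z + phi z y = phi x y.
Proof. by move=> <-; rewrite -addrA [phi z y]phi_anti subrr addr0. Qed.

Let closed_blk x y z : inS x -> inS y -> inS z -> phi x y + phi y z = phi x z.
Proof.
(* The vertex sum of [S_c] is 0 mod 3, so its colour is [c]; the other cases are degenerate or
   reorderings of it. *)
have K : phi (3 * c + 1)%N (3 * c + 2)%N + phi (3 * c + 2)%N (3 * c + 3)%N
    = phi (3 * c + 1)%N (3 * c + 3)%N.
  by apply: phi_closed; [lia|lia|colour_lia].
have inSE v : inS v -> [\/ v = 3 * c + 1, v = 3 * c + 2 | v = 3 * c + 3]%N.
  rewrite /inS => vS; have : (v = 3 * c + 1 \/ v = 3 * c + 2 \/ v = 3 * c + 3)%N by lia.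
  by case=> [|[]] ->; [constructor 1|constructor 2|constructor 3].
move=> /inSE[]-> /inSE[]-> /inSE[]->; rewrite ?phi_diag ?addr0 ?add0r //.
all: try by rewrite [X in X + _]phi_anti addNr.
all: first [exact: K|exact: closedC12|exact: closedC23
  |exact/closedC12/closedC23|exact/closedC23/closedC12
  |exact/closedC23/closedC12/closedC23].
Qed.

(** With two vertices in [S_c], a single residue of the vertex sum gives a colour other than [c],
    and it would force [p = anchor y]. *)
Let closed_anchor y p : (0 < y <= N)%N -> ~~ inS y -> inS p ->
  phi (anchor y) p + phi p y = phi (anchor y) y.
Proof.
move=> yN yS pS; case: (eqVneq p (anchor y)) => [->|pa].
  by rewrite phi_diag add0r.
have aS := anchorP y.
have aE : (anchor y = 3 * c + 1 + (y + 2 + (3 * c + 3 < y)) %% 3)%N by [].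
move: (anchor y) aS aE pa => a; rewrite /inS in yS pS * => aS aE /eqP pa.
have [yc|yc] : (y <= 3 * c \/ 3 * c + 3 < y)%N by lia.
- have [pa'|pa'] : (p < a \/ a < p)%N by lia.
  + have K : phi y p + phi p a = phi y a by apply: phi_closed; [lia|lia|colour_lia].
    by apply/closedC23/closedC12/closedC23.
  + have K : phi y a + phi a p = phi y p by apply: phi_closed; [lia|lia|colour_lia].
    by apply/closedC23/closedC12.
- have [pa'|pa'] : (p < a \/ a < p)%N by lia.
  + have K : phi p a + phi a y = phi p y by apply: phi_closed; [lia|lia|colour_lia].
    exact: closedC12.
  + by apply: phi_closed; [lia|lia|colour_lia].
Qed.

Let closed_outside y z : (0 < y < z)%N -> (z <= N)%N -> ~~ inS y -> ~~ inS z ->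
  exists2 p, inS p & phi y p + phi p z = phi y z.
Proof.
move=> yz zN yS zS.
(* Modulo 3 this is 2 - r(y) - r(z), the residue at which the vertex sum selects [p], be it the
   last, middle or first vertex. *)
pose p := (3 * c + 1 + (4 + 2 * (y + z + (3 * c + 3 < y) + (3 * c + 3 < z))) %% 3)%N.
have pS : inS p by rewrite /inS /p; lia.
exists p => //.
have pE : (p = 3 * c + 1 + (4 + 2 * (y + z + (3 * c + 3 < y) + (3 * c + 3 < z))) %% 3)%N by [].
move: p pS pE => p; rewrite /inS in yS zS * => pS pE.
have [yc|yc] : (y <= 3 * c \/ 3 * c + 3 < y)%N by lia.
- have [zc|zc] : (z <= 3 * c \/ 3 * c + 3 < z)%N by lia.
  + have K : phi y z + phi z p = phi y p by apply: phi_closed; [lia|lia|colour_lia].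
    exact: closedC23.
  + by apply: phi_closed; [lia|lia|colour_lia].
- have K : phi p y + phi y z = phi p z by apply: phi_closed; [lia|lia|colour_lia].
  exact: closedC12.
Qed.

(** The paths from [3c+1] to [y] through [anchor y] and through [p] have the same integral. *)
Let pot_blk p y : (0 < y <= N)%N -> inS p -> phi p y = pot y - pot p.
Proof.
move=> yN pS; rewrite /pot (anchor_id pS) phi_diag addr0.
have sS : inS (3 * c + 1) by rewrite /inS; lia.
have [yS|yS] := boolP (inS y).
  by rewrite anchor_id // phi_diag addr0 -(closed_blk sS pS yS) [RHS]addrC addKr.
rewrite -(closed_anchor yN yS pS) addrA (closed_blk sS (anchorP y) pS).
by rewrite [RHS]addrC addKr.
Qed.

Lemma monochromatic_closed_exact :
  {f | forall y z, (0 < y < z)%N -> (z <= N)%N -> phi y z = f z - f y}.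
Proof.
exists pot => y z yz zN.
have [yS|yS] := boolP (inS y); first by apply: pot_blk => //; lia.
have [zS|zS] := boolP (inS z).
  by rewrite phi_anti pot_blk ?opprB //; lia.
have [p pS <-] := closed_outside yz zN yS zS.
rewrite [phi y p]phi_anti !pot_blk ?opprB //; try lia.
by rewrite addrC addrA subrK.
Qed.

End MonochromaticCochain.

(** * Entries and left kernel of the coefficient matrix *)

Section Coefficients.
Variables (k : fieldType) (V : vectType k) (d : nat).
Implicit Types (v : {ffun trip d -> V}) (w : 'rV[k]_(d * 'C((3 * d).-1, 2))).

Lemma big_nat_delta (W : lmodType k) (a b i : nat) (F : nat -> W) :
  \sum_(a <= r < b) (r == i)%:R *: F r = if (a <= i < b)%N then F i else 0.
Proof.
rewrite -(big_nat1_eq +%R F) [RHS]big_mkcond; apply: eq_bigr => r _.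
by case: eqP; rewrite ?scale1r ?scale0r.
Qed.

(** The unknown of a triangle occurs only in the equations of its three edges, as in a coboundary
    matrix up to signs. *)
Lemma eqn_lhs_unit v i j l m n : (0 < i < j)%N -> (j < l <= 3 * d)%N -> (0 < m < n)%N ->
  eqn_lhs v (fun u => (u == (i, j, l))%:R) m n =
  (((m, n) == (j, l))%:R * (-1) ^+ i.-1 + ((m, n) == (i, l))%:R * (-1) ^+ j
   + ((m, n) == (i, j))%:R * (-1) ^+ l.+1) *: at3 v i j l.
Proof.
move=> ij jl mn; rewrite /eqn_lhs !scalerDl; congr (_ + _ + _).
- rewrite (eq_bigr (fun r => (r == i)%:R *:
    ((((m, n) == (j, l))%:R * (-1) ^+ r.-1) *: at3 v r m n))) => [|r _]; last first.
    rewrite scalerA; congr (_ *: _); rewrite !xpair_eqE -andbA.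
    by case: (r == i); rewrite ?mul0r ?mulr0 //= mul1r mulrC.
  rewrite big_nat_delta; case: (eqVneq (m, n) (j, l)) => [[-> ->]|_].
    by rewrite ifT.
  by rewrite !mul0r !scale0r if_same.
- rewrite (eq_bigr (fun r => (r == j)%:R *:
    ((((m, n) == (i, l))%:R * (-1) ^+ r) *: at3 v m r n))) => [|r _]; last first.
    rewrite scalerA; congr (_ *: _); rewrite !xpair_eqE andbAC.
    by case: (r == j); rewrite ?andbF ?andbT ?mul0r ?mulr0 //= mul1r mulrC.
  rewrite big_nat_delta; case: (eqVneq (m, n) (i, l)) => [[-> ->]|_].
    by rewrite ifT //; lia.
  by rewrite !mul0r !scale0r if_same.
- rewrite (eq_bigr (fun r => (r == l)%:R *:
    ((((m, n) == (i, j))%:R * (-1) ^+ r.+1) *: at3 v m n r))) => [|r _]; last first.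
    rewrite scalerA; congr (_ *: _); rewrite !xpair_eqE.
    by case: (r == l); rewrite ?andbF ?andbT ?mul0r ?mulr0 //= mul1r mulrC.
  rewrite big_nat_delta; case: (eqVneq (m, n) (i, j)) => [[-> ->]|_].
    by rewrite ifT //; lia.
  by rewrite !mul0r !scale0r if_same.
Qed.

Variable e : d.-tuple V.

Definition e3_family : {ffun trip d -> V} :=
  [ffun t : trip d => let: (i, j, l) := ssval t in e3 e i j l].

Lemma at3_e3_family i j l : (0 < i < j)%N -> (j < l <= 3 * d)%N ->
  at3 e3_family i j l = e`_(colour i j l).
Proof.
move=> ij jl; rewrite /at3; case: insubP => [t _ tE|]; last by rewrite mem_triples ij jl.
by rewrite ffunE; move: tE => /= ->.
Qed.

Lemma colour_lt i j l : (0 < i < j)%N -> (j < l <= 3 * d)%N -> (colour i j l < d)%N.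
Proof.
by rewrite /colour /blk => ij jl; case: ((i + j + l) %% 3)%N => [|[|_]]; lia.
Qed.

(* The entry of [w] in the row of the pair [(m, n)] and coordinate [c]; for
   [n = 3d] there is no such row, and the value is [0] because [index] then
   returns the length of the list of pairs. *)
Definition row_entry w (c m n : nat) : k :=
  if insub (index (m, n) (pairs (3 * d).-1) * d + c)%N is Some p then w 0 p else 0.

Lemma row_entry_out w c m : row_entry w c m (3 * d) = 0.
Proof.
rewrite /row_entry memNindex ?size_pairs; last by rewrite mem_pairs; lia.
by rewrite insubF //; apply/negbTE; rewrite -leqNgt mulnC leq_addr.
Qed.

Lemma row_pair_lt (p : 'I_(d * 'C((3 * d).-1, 2))) :
  (p %/ d < size (pairs (3 * d).-1))%N.
Proof. by rewrite size_pairs ltn_divLR 1?[X in (_ < X)%N]mulnC ?(row_gt0 p). Qed.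

Lemma row_pairE (p : 'I_(d * 'C((3 * d).-1, 2))) (c : nat) x : (c < d)%N ->
  (p == index x (pairs (3 * d).-1) * d + c :> nat)%N =
  (p %% d == c)%N && (nth (0, 0)%N (pairs (3 * d).-1) (p %/ d) == x).
Proof.
move=> cd; have pC := row_pair_lt p.
apply/eqP/andP => [pE|[/eqP<- /eqP<-]]; last first.
  by rewrite index_uniq ?pairs_uniq // -divn_eq.
have dE : (p %/ d = index x (pairs (3 * d).-1))%N.
  by rewrite pE divnMDl ?divn_small ?addn0 //; lia.
by rewrite {1}pE modnMDl modn_small // eqxx dE nth_index // -index_mem -dE.
Qed.

Lemma sum_row_entry w (c m n : nat) : (c < d)%N ->
  \sum_p w 0 p * ((p %% d == c)%N
    && (nth (0, 0)%N (pairs (3 * d).-1) (p %/ d) == (m, n)))%:R = row_entry w c m n.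
Proof.
move=> cd; under eq_bigr do rewrite -row_pairE //.
rewrite /row_entry; case: insubP => [q _ qE|qN].
  rewrite (bigD1 q) //= -qE eqxx mulr1 big1 ?addr0 // => p /negPf pq.
  by rewrite [_ == _]pq mulr0.
rewrite big1 // => p _; case: eqP => [pE|_]; last by rewrite mulr0.
by rewrite -pE ltn_ord in qN.
Qed.

Hypothesis e_basis : basis_of {:V} e.

(** Each vector of the family is a basis vector, so a column meets only the rows of its own colour
    and the kernel equations separate by colour. *)
Lemma A3_left_kernel w i j l : w *m A3 e e3_family = 0 ->
  (0 < i < j)%N -> (j < l <= 3 * d)%N ->
  let u := row_entry w (colour i j l) in
  (-1) ^+ i.-1 * u j l + (-1) ^+ j * u i l + (-1) ^+ l.+1 * u i j = 0.
Proof.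
move=> wA ij jl /=; set c := colour i j l; have cd : (c < d)%N := colour_lt ij jl.
have tT : (i, j, l) \in triples (3 * d) by rewrite mem_triples ij jl.
have qP : (index (i, j, l) (triples (3 * d)) < d * 'C((3 * d).-1, 2))%N.
  by rewrite -size_triples3 index_mem.
have := congr1 (fun M : 'rV_ _ => M 0 (Ordinal qP)) wA.
rewrite !mxE => <-; rewrite -!sum_row_entry // !mulr_sumr -!big_split /=.
apply: eq_bigr => p _; rewrite mxE /= nth_index //.
have := mem_nth (0, 0)%N (row_pair_lt p).
case: (nth _ _ _) => m n; rewrite mem_pairs => /andP[mn _].
rewrite eqn_lhs_unit // at3_e3_family // linearZ /=.
have -> : e`_(colour i j l) = e`_(Ordinal cd) by [].
rewrite coord_free ?(basis_free e_basis) //.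
rewrite [Ordinal cd == _]eq_sym -[Ordinal _ == _]/(p %% d == c)%N.
case: (p %% d == c)%N; rewrite ?andTb ?andFb ?mulr0 ?addr0 // mulr1; ring.
Qed.

Lemma row_entry_eq0 w (c m n : nat) : w *m A3 e e3_family = 0 -> (c < d)%N ->
  (0 < m < n)%N -> (n <= 3 * d)%N -> row_entry w c m n = 0.
Proof.
move=> wA cd mn nN.
(* The sign [(-1) ^+ (x + y)] turns the kernel relations into closedness. *)
pose phi x y : k := if (x < y)%N then (-1) ^+ (x + y) * row_entry w c x y
  else if (y < x)%N then - ((-1) ^+ (x + y) * row_entry w c y x) else 0.
have phi_lt x y : (x < y)%N -> phi x y = (-1) ^+ (x + y) * row_entry w c x y.
  by rewrite /phi => ->.
have phi_anti x y : phi x y = - phi y x.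
  by rewrite /phi [(y + x)%N]addnC; case: ltngtP; rewrite ?opprK ?oppr0.
have phi_diag x : phi x x = 0 by rewrite /phi ltnn.
have phi_closed i j l : (0 < i < j)%N -> (j < l <= 3 * d)%N ->
    colour i j l = c -> phi i j + phi j l = phi i l.
  move=> ij jl ijlc; have := A3_left_kernel wA ij jl; rewrite /= ijlc.
  rewrite !phi_lt; try lia; move=> K.
  have sq x : (-1) ^+ x * (-1) ^+ x = 1 :> k by rewrite -exprMn mulrNN mulr1 expr1n.
  case: i ij {ijlc} K => // i ij K.
  (* Here [i] is one less than the least vertex; the factor makes the edge signs those of [phi]. *)
  have := congr1 ( *%R ((-1) ^+ (i + j + l))) K; rewrite mulr0 /= => {}K.
  apply/eqP; rewrite -subr_eq0 -K !exprD !exprS /=; apply/eqP.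
  set a := (-1) ^+ i in K *; set b := (-1) ^+ j; set g := (-1) ^+ l.
  have -> : a * b * g * (a * row_entry w c j l + b * row_entry w c i.+1 l
      + -1 * g * row_entry w c i.+1 j)
    = (a * a) * b * g * row_entry w c j l + a * (b * b) * g * row_entry w c i.+1 l
      - a * b * (g * g) * row_entry w c i.+1 j by ring.
  by rewrite !sq; ring.
have cN : (3 * c + 3 <= 3 * d)%N by lia.
have [f fP] := monochromatic_closed_exact cN phi_anti phi_diag phi_closed.
(* [phi] vanishes on the edges at [3d], which have no rows, so the potential is constant. *)
have fN x : (0 < x <= 3 * d)%N -> f x = f (3 * d)%N.
  move=> xN; have [->//|x3d] := eqVneq x (3 * d)%N.
  apply/eqP; rewrite eq_sym -subr_eq0 -fP ?phi_lt ?row_entry_out ?mulr0 //; lia.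
have := fP m n mn nN; rewrite phi_lt; last lia.
rewrite (fN m) ?(fN n) ?subrr; try lia.
by move/eqP; rewrite mulf_eq0 signr_eq0 => /eqP.
Qed.

Lemma det_A3_e3_family : \det (A3 e e3_family) != 0.
Proof.
apply/negP => /det0P[w w0 wA]; case/eqP: w0; apply/rowP => p; rewrite mxE.
have d0 := row_gt0 p.
have := mem_nth (0, 0)%N (row_pair_lt p).
case E: (nth _ _ _) => [m n]; rewrite mem_pairs => /andP[mn nN].
have /eqP pE : (p == index (m, n) (pairs (3 * d).-1) * d + p %% d :> nat)%N.
  by rewrite row_pairE ?ltn_pmod // E !eqxx.
have := @row_entry_eq0 w (p %% d) m n wA (ltn_pmod _ d0) mn.
by rewrite /row_entry -pE valK; apply; lia.
Qed.

End Coefficients.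

Theorem lemma3p7 (k : fieldType) (hk : [pchar k] =i pred0)
    (d : nat) (hd : (2 <= d)%N)
    (V : vectType k) (e : d.-tuple V) (he : basis_of {:V} e) :
  detS3 e (E3 e) != 0 /\ (exists x : tpow V (trip d), detS3 e x != 0).
Proof.
have nz : detS3 e (E3 e) != 0 by rewrite detS3_pure det_A3_e3_family.
by split; last exists (E3 e).
Qed.
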